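(* Let $\mathcal C$ be a small category and $\mathbb X$ a $\mathcal C$-space. In the definition of $\mathrm{TC}_{\mathcal C}(\mathbb X)$, homotopy local sections of $\pi_{\mathbb X}$ may be replaced by strict local sections. That is, $\mathrm{TC}_{\mathcal C}(\mathbb X)$ equals the least integer $n\geq0$ such that $\mathbb X\times\mathbb X$ admits an open cover $\{\mathbb U_0,\dots,\mathbb U_n\}$ by open $\mathcal C$-subspaces for each of which there is a $\mathcal C$-map $s_i\colon\mathbb U_i\to\mathbb X^{\mathbb I}$ with $\pi_{\mathbb X}\circ s_i=\iota_{\mathbb U_i}$ (and $\infty$ if no such finite cover exists).
   Context: $\mathrm{Top}$ is the category of compactly generated topological spaces; products, subspaces and mapping spaces are taken in compactly generated spaces (mapping spaces with the compactly generated compact-open topology). A $\mathcal C$-space is a functor $\mathbb X\colon\mathcal C\to\mathrm{Top}$; a $\mathcal C$-map is a natural transformation. Products are objectwise; a space $K$ is also regarded as a constant $\mathcal C$-space; $\mathbb I=[0,1]$. A $\mathcal C$-homotopy from $f$ to $g$ (with $f,g\colon\mathbb X\to\mathbb Y$) is a $\mathcal C$-map $H\colon\mathbb X\times\mathbb I\to\mathbb Y$ with $H_0=f$, $H_1=g$; then write $f\simeq_{\mathcal C}g$. An open $\mathcal C$-subspace $\mathbb U\subseteq\mathbb Y$ is a family of open subspaces $\mathbb U(c)\subseteq\mathbb Y(c)$ stable under the structure maps (with restricted structure maps); $\iota_{\mathbb U}\colon\mathbb U\hookrightarrow\mathbb Y$ is the inclusion. An open cover of $\mathbb Y$ is a collection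 $\{\mathbb U_i\}$ of open $\mathcal C$-subspaces with $\mathbb Y(c)=\bigcup_i\mathbb U_i(c)$ for every object $c$. For a $\mathcal C$-map $p\colon\mathbb E\to\mathbb B$, a homotopy local section over an open $\mathcal C$-subspace $\mathbb U\subseteq\mathbb B$ is a $\mathcal C$-map $s\colon\mathbb U\to\mathbb E$ with $p\circ s\simeq_{\mathcal C}\iota_{\mathbb U}$; it is strict if $p\circ s=\iota_{\mathbb U}$. $\mathrm{sec}_{\mathcal C}(p)$ is the least integer $n\ge0$ such that $\mathbb B$ has an open cover by $n+1$ open $\mathcal C$-subspaces each admitting a homotopy local section ($\infty$ if none exists). The path $\mathcal C$-space $\mathbb X^{\mathbb I}$ is given by $\mathbb X^{\mathbb I}(c)=\mathrm{Hom}_{\mathrm{Top}}(\mathbb I,\mathbb X(c))$, $\mathbb X^{\mathbb I}(\alpha)(\gamma)=\mathbb X(\alpha)\circ\gamma$; the endpoint evaluation $\pi_{\mathbb X}\colon\mathbb X^{\mathbb I}\to\mathbb X\times\mathbb X$ is $\pi_{\mathbb X,c}(\gamma)=(\gamma(0),\gamma(1))$; and $\mathrm{TC}_{\mathcal C}(\mathbb X)=\mathrm{sec}_{\mathcal C}(\pi_{\mathbb X})$. *)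

(* Defs.v *)
From HB Require Import structures.
From mathcomp Require Import all_boot all_order all_algebra.
From mathcomp Require Import all_classical all_reals topology normedtype.

Set Implicit Arguments.
Unset Strict Implicit.
Unset Printing Implicit Defensive.

Import Order.TTheory GRing.Theory Num.Theory.
Import numFieldNormedType.Exports.

Local Open Scope classical_set_scope.
Local Open Scope ring_scope.

(* Compactly generated means: the topology is final with respect to the
   continuous maps from compact Hausdorff spaces. No separation axiom is
   imposed. The sets open in the resulting topology are the kopen ones. *)
Definition kopen (T : topologicalType) (A : set T) : Prop :=
  forall (K : topologicalType) (u : K -> T),
    compact [set: K] -> hausdorff_space K -> continuous u -> open (u @^-1` A).

HB.mixin Record isCompactlyGenerated T & Topological T := {
  kopen_open : forall A : set T, kopen A -> open A
}.

#[short(type="cgTopologicalType")]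
HB.structure Definition CGTopological :=
  {T of Topological T & isCompactlyGenerated T}.

Lemma compact_hausdorff_cg (T : topologicalType) :
  compact [set: T] -> hausdorff_space T ->
  forall A : set T, kopen A -> open A.
Proof. by move=> cT hT A /(_ T idfun cT hT); apply=> x; exact: cts_fun. Qed.

Lemma open_kopen (T : topologicalType) (A : set T) : open A -> kopen A.
Proof. by move=> oA K u _ _ /continuousP; exact. Qed.

Definition kification (T : topologicalType) : Type := T.

Section kification.
Variable T : topologicalType.

Let kopenT : kopen [set: T].
Proof. by move=> K u _ _ _; rewrite preimage_setT; exact: openT. Qed.

Let kopenI (A B : set T) : kopen A -> kopen B -> kopen (A `&` B).
Proof.
by move=> kA kB K u cK hK cu; apply: openI; [exact: kA|exact: kB].
Qed.

Let kopen_bigcup (I : Type) (f : I -> set T) :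
  (forall i, kopen (f i)) -> kopen (\bigcup_i f i).
Proof.
move=> kf K u cK hK cu; rewrite preimage_bigcup.
by apply: bigcup_open => i _; exact: kf.
Qed.

HB.instance Definition _ := Choice.on (kification T).
HB.instance Definition _ :=
  isOpenTopological.Build (kification T) kopenT kopenI kopen_bigcup.

Lemma kification_openE (A : set (kification T)) :
  open A = kopen (A : set T).
Proof. reflexivity. Qed.

Lemma continuous_of_kification : continuous (id : kification T -> T).
Proof. by apply/continuousP => A oA; rewrite kification_openE; exact: open_kopen. Qed.

Lemma continuous_compact_kification (K : topologicalType) (u : K -> T) :
  compact [set: K] -> hausdorff_space K -> continuous u ->
  continuous (u : K -> kification T).
Proof. by move=> cK hK cu; apply/continuousP => A; rewrite kification_openE; exact. Qed.

Let kification_cg (A : set (kification T)) : kopen A -> open A.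
Proof.
rewrite kification_openE => kA K u cK hK cu; apply: (kA K u cK hK).
exact: continuous_compact_kification.
Qed.

HB.instance Definition _ :=
  isCompactlyGenerated.Build (kification T) kification_cg.

End kification.

Lemma continuous_kification_map (S T : topologicalType) (f : S -> T) :
  continuous f -> continuous (f : kification S -> kification T).
Proof.
move=> cf; apply/continuousP => A; rewrite !kification_openE => kA K u cK hK cu.
apply: (kA K (f \o u)) => //.
by move=> x; apply: continuous_comp; [exact: cu|exact: cf].
Qed.

Lemma continuous_to_kification (X : cgTopologicalType) (T : topologicalType)
    (f : X -> T) :
  continuous f -> continuous (f : X -> kification T).
Proof.
move=> cf; apply/continuousP => A; rewrite kification_openE => kA.
apply: kopen_open => K u cK hK cu.
apply: (kA K (f \o u)) => //.
by move=> x; apply: continuous_comp; [exact: cu|exact: cf].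
Qed.

Definition unit_interval (R : realType) : Type := `[0 : R, 1]%classic.

Section unit_interval.
Variable R : realType.

HB.instance Definition _ := Topological.on (unit_interval R).

Lemma unit_interval_compact : compact [set: unit_interval R].
Proof.
move=> F PF _; pose G : set_system R := set_val @ F.
have GA : G `[0, 1]%classic.
  by apply: (@filterS _ F _ setT _ _ filterT) => x _; exact: set_valP.
have [p [pA Gp]] := @segment_compact R 0 1 G _ GA.
exists (exist _ p (mem_set pA)); split=> // B N FB; rewrite nbhsE => -[_ [[O oO <-] Op] ON].
have [_ [[x Bx <-] Ox]] : (set_val @` B) `&` O !=set0.
  apply: Gp; last exact: open_nbhs_nbhs.
  by apply: (@filterS _ F _ B _ _ FB) => x Bx; exists x.
by exists x; split=> //; exact: ON.
Qed.

Lemma unit_interval_hausdorff : hausdorff_space (unit_interval R).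
Proof.
move=> x y xy; apply: val_inj; apply: (@Rhausdorff R) => A B nA nB.
have [z [Az Bz]] := xy _ _ (@initial_continuous _ R set_val x A nA)
  (@initial_continuous _ R set_val y B nB).
by exists (set_val z).
Qed.

HB.instance Definition _ := isCompactlyGenerated.Build (unit_interval R)
  (compact_hausdorff_cg unit_interval_compact unit_interval_hausdorff).

Lemma I0_subproof : (0 : R) \in `[0 : R, 1]%classic.
Proof. by rewrite inE /= in_itv /= lexx ler01. Qed.

Lemma I1_subproof : (1 : R) \in `[0 : R, 1]%classic.
Proof. by rewrite inE /= in_itv /= lexx ler01. Qed.

Definition I0 : unit_interval R := exist _ 0 I0_subproof.
Definition I1 : unit_interval R := exist _ 1 I1_subproof.

End unit_interval.
Arguments I0 {R}.
Arguments I1 {R}.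

(* The library puts the compact-open topology on all functions X -> Y; it is
   restricted to the continuous ones. Its subbase uses compact subsets of X
   rather than maps from compact Hausdorff spaces to X, which makes no
   difference when X is Hausdorff, and only X = [0, 1] is used. *)
Definition map_space (X Y : topologicalType) : Type := continuousType X Y.

HB.instance Definition _ (X Y : topologicalType) := Topological.copy
  (map_space X Y)
  (initial_topology (id : continuousType X Y -> {compact-open, X -> Y})).

Section map_space.
Variables X Y : topologicalType.

Lemma map_space_open (K : set X) (O : set Y) : compact K -> open O ->
  open [set h : map_space X Y | (h : continuousType X Y) @` K `<=` O].
Proof.
move=> cK oO.
by exists [set g : {compact-open, X -> Y} | g @` K `<=` O] => //;
  exact: compact_open_open.
Qed.

Lemma map_space_eval_continuous (t : X) :
  continuous (fun h : map_space X Y => (h : continuousType X Y) t).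
Proof.
apply/continuousP => O oO.
have -> : (fun h : map_space X Y => (h : continuousType X Y) t) @^-1` O =
    [set h : map_space X Y | (h : continuousType X Y) @` [set t] `<=` O].
  apply/seteqP; split=> h /=; first by move=> ? _ [_ -> <-].
  by apply; exists t.
by apply: map_space_open => //; exact: compact_set1.
Qed.

End map_space.

Lemma map_space_comp_continuous (X Y Z : topologicalType)
    (f : continuousType Y Z) :
  continuous (fun h : map_space X Y =>
    (f \o (h : continuousType X Y) : continuousType X Z) : map_space X Z).
Proof.
apply: continuous_comp_initial => g.
apply/compact_open_cvgP; first by apply: fmap_filter; exact: nbhs_filter.
move=> K O cK oO fO.
have oO' : open (f @^-1` O) by apply: open_comp => // x _; exact: cts_fun.
apply: (@filterS _ (nbhs g) _ _ _ _ (open_nbhs_nbhs (conj (map_space_open cK oO') _))).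
  by move=> h hO _ [t Kt <-]; apply: hO; exists t.
by move=> _ [t Kt <-]; apply: fO; exists t.
Qed.

Notation kprod X Y := (kification (X * Y)%type).
Notation ksub A := (kification (set_type A)).
Notation kmap X Y := (kification (map_space X Y)).

Record smallCategory := SmallCategory {
  ob :> Type;
  hom : ob -> ob -> Type;
  idm : forall a, hom a a;
  compm : forall a b c, hom b c -> hom a b -> hom a c;
  comp1m : forall a b (f : hom a b), compm (idm b) f = f;
  compm1 : forall a b (f : hom a b), compm f (idm a) = f;
  compmA : forall a b c d (h : hom c d) (g : hom b c) (f : hom a b),
    compm h (compm g f) = compm (compm h g) f
}.

Record cspace (C : smallCategory) := CSpace {
  cs_obj :> C -> cgTopologicalType;
  cs_map : forall a b, hom a b -> continuousType (cs_obj a) (cs_obj b);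
  cs_map1 : forall a x, cs_map (idm a) x = x;
  cs_mapM : forall a b c (g : hom b c) (f : hom a b) x,
    cs_map (compm g f) x = cs_map g (cs_map f x)
}.

Record cmap (C : smallCategory) (X Y : cspace C) := CMap {
  cm_fun :> forall c : C, continuousType (X c) (Y c);
  cm_natural : forall a b (f : hom a b) x,
    cm_fun b (cs_map X f x) = cs_map Y f (cm_fun a x)
}.

Lemma cmapP (C : smallCategory) (X Y : cspace C) (f g : cmap X Y) :
  f = g <-> forall c x, f c x = g c x.
Proof.
split=> [-> //|]; case: f g => [f fn] [g gn] /= fg.
have {}fg : f = g.
  apply: functional_extensionality_dep => c.
  by apply/continuousEP; exact: fg.
by subst g; congr CMap; exact: Prop_irrelevance.
Qed.

Section cmap_comp.
Variables (C : smallCategory) (X Y Z : cspace C) (g : cmap Y Z) (f : cmap X Y).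

Let cmap_comp_natural a b (h : hom a b) (x : X a) :
  (g b \o f b) (cs_map X h x) = cs_map Z h ((g a \o f a) x).
Proof. by rewrite /= !cm_natural. Qed.

Definition cmap_comp : cmap X Z := CMap cmap_comp_natural.

End cmap_comp.

Section const_cspace.
Variables (C : smallCategory) (K : cgTopologicalType).

Definition const_cspace : cspace C :=
  @CSpace C (fun=> K) (fun _ _ _ => idfun) (fun _ _ => erefl)
    (fun _ _ _ _ _ _ => erefl).

End const_cspace.

Section prod_cspace.
Variables (C : smallCategory) (X Y : cspace C).

Definition prod_fun a b (f : hom a b) (xy : kprod (X a) (Y a)) :
  kprod (X b) (Y b) := (cs_map X f xy.1, cs_map Y f xy.2).

Let prod_fun_continuous a b (f : hom a b) : continuous (prod_fun f).
Proof.
apply: continuous_kification_map => -[x y]; apply: cvg_pair.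
  by apply: (cvg_comp fst (cs_map X f)); [exact: cvg_fst|exact: cts_fun].
by apply: (cvg_comp snd (cs_map Y f)); [exact: cvg_snd|exact: cts_fun].
Qed.

Let prod_fun1 a xy : prod_fun (idm a) xy = xy.
Proof. by case: xy => x y; rewrite /prod_fun !cs_map1. Qed.

Let prod_funM a b c (g : hom b c) (f : hom a b) xy :
  prod_fun (compm g f) xy = prod_fun g (prod_fun f xy).
Proof. by rewrite /prod_fun !cs_mapM. Qed.

Definition prod_cspace : cspace C :=
  @CSpace C (fun c => kprod (X c) (Y c))
    (fun a b f => mkcts (@prod_fun_continuous a b f)) prod_fun1 prod_funM.

End prod_cspace.

Definition chomotopic (R : realType) (C : smallCategory) (X Y : cspace C)
    (f g : cmap X Y) : Prop :=
  exists H : cmap (prod_cspace X (const_cspace C (unit_interval R))) Y,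
    forall (c : C) (x : X c), H c (x, I0) = f c x /\ H c (x, I1) = g c x.

Record open_csubspace (C : smallCategory) (Y : cspace C) := OpenCSubspace {
  ocs_set :> forall c : C, set (Y c);
  ocs_open : forall c, open (@ocs_set c);
  ocs_stable : forall a b (f : hom a b) x,
    @ocs_set a x -> @ocs_set b (cs_map Y f x)
}.
Arguments ocs_set {C Y} _ c _.

Section open_csubspace.
Variables (C : smallCategory) (Y : cspace C) (U : open_csubspace Y).

Let sub_fun_subproof a b (f : hom a b) (x : ksub (U a)) :
  cs_map Y f (set_val x) \in U b.
Proof. by apply/mem_set/ocs_stable/set_mem; exact: valP. Qed.

Definition sub_fun a b (f : hom a b) (x : ksub (U a)) : ksub (U b) :=
  exist _ (cs_map Y f (set_val x)) (sub_fun_subproof f x).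

Let sub_fun_continuous a b (f : hom a b) : continuous (sub_fun f).
Proof.
apply: continuous_kification_map; apply: continuous_comp_initial => x.
apply: (@continuous_comp (U a) _ _ set_val (cs_map Y f)); last exact: cts_fun.
exact: (@initial_continuous (U a) (Y a) set_val x).
Qed.

Let sub_fun1 a x : sub_fun (idm a) x = x.
Proof. by apply: val_inj; rewrite /= cs_map1. Qed.

Let sub_funM a b c (g : hom b c) (f : hom a b) x :
  sub_fun (compm g f) x = sub_fun g (sub_fun f x).
Proof. by apply: val_inj; rewrite /= cs_mapM. Qed.

Definition sub_cspace : cspace C :=
  @CSpace C (fun c => ksub (U c))
    (fun a b f => mkcts (@sub_fun_continuous a b f)) sub_fun1 sub_funM.

Let incl_fun c (x : ksub (U c)) : Y c := set_val x.

Let incl_fun_continuous c : continuous (@incl_fun c).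
Proof.
move=> x; apply: (@continuous_comp (ksub (U c)) (U c) _ id set_val).
  exact: continuous_of_kification.
exact: (@initial_continuous (U c) (Y c) set_val x).
Qed.

Definition csub_incl : cmap sub_cspace Y :=
  @CMap C sub_cspace Y (fun c => mkcts (@incl_fun_continuous c))
    (fun _ _ _ _ => erefl).

End open_csubspace.

Coercion sub_cspace : open_csubspace >-> cspace.

Definition open_cover (C : smallCategory) (Y : cspace C) (I : Type)
    (U : I -> open_csubspace Y) : Prop :=
  forall (c : C) (y : Y c), exists i, U i c y.

(* None stands for infinity. *)
Definition least (P : nat -> Prop) : option nat :=
  if pselect (exists n, `[< P n >]) is left exP then Some (ex_minn exP)
  else None.

Lemma least_SomeP (P : nat -> Prop) n :
  least P = Some n <-> P n /\ forall m, P m -> (n <= m)%N.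
Proof.
rewrite /least; case: pselect => [exP|nexP]; last first.
  by split=> // -[Pn _]; exfalso; apply: nexP; exists n; exact/asboolP.
case: ex_minnP => k /asboolP Pk kmin; split=> [[<-]|[Pn nmin]].
  by split=> // m Pm; apply: kmin; exact/asboolP.
congr Some; apply/eqP; rewrite eqn_leq nmin// andbT.
by apply: kmin; exact/asboolP.
Qed.

Lemma least_NoneP (P : nat -> Prop) : least P = None <-> forall n, ~ P n.
Proof.
rewrite /least; case: pselect => [exP|nexP]; split=> //.
  by move=> nP; have [n /asboolP /nP] := exP.
by move=> _ n Pn; apply: nexP; exists n; exact/asboolP.
Qed.

Section sectional_category.
Variables (R : realType) (C : smallCategory) (E B : cspace C) (p : cmap E B).

Definition homotopy_local_section (U : open_csubspace B) (s : cmap U E) : Prop :=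
  chomotopic R (cmap_comp p s) (csub_incl U).

Definition sec : option nat :=
  least (fun n => exists U : 'I_n.+1 -> open_csubspace B,
    open_cover U /\ forall i, exists s : cmap (U i) E, homotopy_local_section s).

End sectional_category.

Section path_cspace.
Variables (R : realType) (C : smallCategory) (X : cspace C).
Local Notation I := (unit_interval R).

Definition path_fun a b (f : hom a b) (g : kmap I (X a)) : kmap I (X b) :=
  (cs_map X f \o (g : continuousType I (X a)) : continuousType I (X b)).

Let path_fun_continuous a b (f : hom a b) : continuous (path_fun f).
Proof. exact/continuous_kification_map/map_space_comp_continuous. Qed.

Let path_fun1 a g : path_fun (idm a) g = g.
Proof. by apply/continuousEP => t; rewrite /= cs_map1. Qed.

Let path_funM a b c (h : hom b c) (f : hom a b) g :
  path_fun (compm h f) g = path_fun h (path_fun f g).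
Proof. by apply/continuousEP => t; rewrite /= cs_mapM. Qed.

Definition path_cspace : cspace C :=
  @CSpace C (fun c => kmap I (X c))
    (fun a b f => mkcts (@path_fun_continuous a b f)) path_fun1 path_funM.

Let endpoints_fun c (g : kmap I (X c)) : kprod (X c) (X c) :=
  ((g : continuousType I (X c)) I0, (g : continuousType I (X c)) I1).

Let endpoints_continuous c : continuous (@endpoints_fun c).
Proof.
apply: continuous_kification_map => g.
apply: cvg_pair; first exact: nbhs_filter.
  exact: (@map_space_eval_continuous I (X c) I0 g).
exact: (@map_space_eval_continuous I (X c) I1 g).
Qed.

Definition endpoints : cmap path_cspace (prod_cspace X X) :=
  @CMap C path_cspace (prod_cspace X X)
    (fun c => mkcts (@endpoints_continuous c)) (fun _ _ _ _ => erefl).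

Definition TC : option nat := sec R endpoints.

End path_cspace.

(* Main.v *)
Require Import Defs.
From mathcomp Require Import all_boot all_order all_algebra.
From mathcomp Require Import all_classical all_reals topology normedtype.
From mathcomp Require Import lra.

Set Implicit Arguments.
Unset Strict Implicit.
Unset Printing Implicit Defensive.

Import Order.TTheory GRing.Theory Num.Theory.
Import numFieldNormedType.Exports.

Local Open Scope classical_set_scope.
Local Open Scope ring_scope.

(** The endpoint map from paths to pairs of points is a fibration, so a map
    that lifts through it up to homotopy lifts through it strictly, and the lift
    can be written down by a formula that uses no choice. Let s send x to a path,
    and let H be a homotopy from the pair of endpoints of s x to g x. The two
    coordinates of H run, as time goes from 0 to 1, from s x 0 to the first
    coordinate of g x, and from s x 1 to the second one. The first of these
    paths reversed, then s x, then the second one, form a path from the first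
    coordinate of g x to the second ([rectified_lift]). The formula commutes
    with every map of spaces, so the new lift is again natural in the objects
    of the category. Applied to the inclusion g of an open subspace, this turns
    a homotopy local section into a strict one over the same subspace, while a
    strict section is a homotopy section by the constant homotopy. Hence both
    kinds of section allow the same covers.

    What requires work is continuity of the new lift for the compactly
    generated mapping space. It has two ingredients. Transposing a
    homotopy on a k-product gives a continuous family of paths
    ([slice_is_continuous]): sources are compactly generated, so continuity is
    tested along maps from a compact Hausdorff space L, where L * [0, 1] is
    itself compact Hausdorff, the k-product imposes nothing new, and ordinary
    currying applies. Concatenating two continuous families of paths gives a
    continuous family ([concat_is_continuous]), by splitting each compact subset
    of [0, 1] at 1/2. *)

(** * Mapping spaces *)

Lemma hausdorff_prod (S T : topologicalType) :
  hausdorff_space S -> hausdorff_space T -> hausdorff_space (S * T)%type.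
Proof.
move=> hS hT [s t] [s' t'] st.
congr pair; [apply: hS|apply: hT] => A B nA nB.
  have [[x y] [/= Ax Bx]] := st (fst @^-1` A) (fst @^-1` B)
    (cvg_fst nA) (cvg_fst nB).
  by exists x.
have [[x y] [/= Ay By]] := st (snd @^-1` A) (snd @^-1` B)
  (cvg_snd nA) (cvg_snd nB).
by exists y.
Qed.

Lemma continuous_to_map_space (S X Y : topologicalType)
    (f : S -> map_space X Y) :
  (forall (K : set X) (O : set Y), compact K -> open O ->
    open [set s | (f s : continuousType X Y) @` K `<=` O]) ->
  continuous f.
Proof.
move=> of_; apply: continuous_comp_initial => s.
apply/compact_open_cvgP => K O cK oO fsO.
exact: (open_nbhs_nbhs (conj (of_ K O cK oO) fsO)).
Qed.

Section precomp.
Variables (X X' Y : topologicalType) (a : continuousType X' X).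

Definition precomp (h : map_space X Y) : map_space X' Y :=
  ((h : continuousType X Y) \o a : continuousType X' Y).

Lemma precomp_continuous : continuous precomp.
Proof.
apply: continuous_to_map_space => K O cK oO.
have -> : [set h | (precomp h : continuousType X' Y) @` K `<=` O] =
    [set h : map_space X Y | (h : continuousType X Y) @` (a @` K) `<=` O].
  by rewrite eqEsubset; split=> h /=; rewrite image_comp.
apply: map_space_open => //; apply: continuous_compact => //.
by apply: continuous_subspaceT => x; exact: cts_fun.
Qed.

End precomp.

Section slice.
Variables (S X : cgTopologicalType) (Y : topologicalType).
Variable h : continuousType (kprod S X) Y.

Let slice_fun s (x : X) : Y := h (s, x).

Let slice_continuous s : continuous (slice_fun s).
Proof.
move=> x.
apply: (@continuous_comp X (kprod S X) Y (fun x => (s, x)) h).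
  apply: continuous_to_kification => z.
  by apply: cvg_pair; [exact: cvg_cst|exact: cvg_id].
exact: cts_fun.
Qed.

Definition slice s : map_space X Y := mkcts (@slice_continuous s).

(** Openness in S is detected on compact Hausdorff spaces L mapping to S.
    Compactness of X is what makes L * X compact Hausdorff, so that [h] pulls
    back to a map that is continuous for the ordinary product topology. *)
Lemma slice_is_continuous :
  compact [set: X] -> hausdorff_space X -> continuous slice.
Proof.
move=> cX hX; apply: continuous_to_map_space => K O cK oO.
apply: kopen_open => L u cL hL cu.
pose g (lx : L * X) := h (u lx.1, lx.2).
have cg : continuous g.
  move=> lx.
  apply: (@continuous_comp _ (kprod S X) Y (fun lx => (u lx.1, lx.2)) h).
    apply: continuous_compact_kification.
    - by rewrite -setXTT; exact: compact_setX.
    - exact: hausdorff_prod.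
    - move=> z; apply: cvg_pair; last exact: cvg_snd.
      by apply: (cvg_comp fst u); [exact: cvg_fst|exact: cu].
  exact: cts_fun.
have := @compact_open_open X Y K O cK oO.
exact: (continuousP (curry g : L -> {compact-open, X -> Y})).1
  (continuous_curry_fun cg) _.
Qed.

End slice.

(** * Reversal and concatenation of paths *)

Section paths.
Variable R : realType.
Local Notation I := (unit_interval R).

Lemma clamp_subproof (r : R) : Num.min 1 (Num.max 0 r) \in `[0 : R, 1]%classic.
Proof.
rewrite inE /= in_itv /=; apply/andP; split.
  by rewrite le_min ler01 le_max lexx.
by rewrite ge_min lexx.
Qed.

(** Retracting the line onto the interval makes the reparametrizations of the
    two halves total, so that pasting needs no paths on subintervals. *)
Definition clamp (r : R) : I :=
  exist _ (Num.min 1 (Num.max 0 r)) (clamp_subproof r).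

Lemma clampK (t : I) : clamp (set_val t) = t.
Proof.
apply: val_inj => /=.
have := set_valP t; rewrite /= in_itv /= => /andP[t0 t1].
by rewrite (max_idPr t0) (min_idPr t1).
Qed.

Lemma clamp0 : clamp 0 = I0.
Proof. exact: (clampK I0). Qed.

Lemma clamp1 : clamp 1 = I1.
Proof. exact: (clampK I1). Qed.

Lemma clamp_continuous : continuous clamp.
Proof.
apply: continuous_comp_initial; apply: min_fun_continuous.
  exact: cst_continuous.
by apply: max_fun_continuous; [exact: cst_continuous|move=> x; exact: cvg_id].
Qed.

Let ramp_fun (a b : R) (t : I) : I := clamp (a * set_val t + b).

Let ramp_continuous a b : continuous (ramp_fun a b).
Proof.
move=> t.
apply: (@continuous_comp I R I set_val (fun r => clamp (a * r + b))).
  exact: (@initial_continuous _ R set_val t).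
apply: (@continuous_comp R R I (fun r => a * r + b) clamp).
  by apply: cvgD; [exact: mulrl_continuous|exact: cvg_cst].
exact: clamp_continuous.
Qed.

Definition ramp a b : continuousType I I := mkcts (@ramp_continuous a b).

Lemma rampE (a b r : R) (t : I) : a * set_val t + b = r -> ramp a b t = clamp r.
Proof. by move=> <-. Qed.

Definition first_half : set I := [set t | set_val t <= 2^-1].
Definition second_half : set I := [set t | 2^-1 <= set_val t].

Lemma closed_first_half : closed first_half.
Proof.
apply: (@closed_comp _ _ set_val [set x : R | x <= 2^-1]); last exact: closed_le.
by move=> t _; exact: (@initial_continuous _ R set_val t).
Qed.

Lemma closed_second_half : closed second_half.
Proof.
apply: (@closed_comp _ _ set_val [set x : R | 2^-1 <= x]); last exact: closed_ge.
by move=> t _; exact: (@initial_continuous _ R set_val t).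
Qed.

Lemma halves (t : I) : first_half t \/ second_half t.
Proof. by have [t1|/ltW t2] := leP (set_val t) 2^-1; [left|right]. Qed.

Section reverse.
Variable Y : topologicalType.

Definition reverse : map_space I Y -> map_space I Y := precomp (ramp (- 1) 1).

Lemma reverse_I0 (p : continuousType I Y) :
  (reverse p : continuousType I Y) I0 = p I1.
Proof. by rewrite /= (@rampE _ _ 1) ?clamp1//= mulr0 add0r. Qed.

Lemma reverse_I1 (p : continuousType I Y) :
  (reverse p : continuousType I Y) I1 = p I0.
Proof. by rewrite /= (@rampE _ _ 0) ?clamp0//= mulr1 addNr. Qed.

End reverse.

Section concat.
Variables (Y : topologicalType) (p q : continuousType I Y) (pq : p I1 = q I0).

Let concat_fun (t : I) : Y :=
  if set_val t <= 2^-1 then p (ramp 2 0 t) else q (ramp 2 (- 1) t).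

Let concat_fun1 t : first_half t -> concat_fun t = p (ramp 2 0 t).
Proof. by move=> t1; rewrite /concat_fun ifT. Qed.

(* At the common point 1/2 the two formulas agree because of pq. *)
Let concat_fun2 t : second_half t -> concat_fun t = q (ramp 2 (- 1) t).
Proof.
rewrite /second_half /= /concat_fun => t2; case: ifP => // t1.
have th : set_val t = 2^-1 by apply/eqP; rewrite eq_le t1 t2.
by rewrite (@rampE _ _ 1) ?(@rampE _ _ 0) ?clamp0 ?clamp1// th; lra.
Qed.

Let concat_preimage (A : set Y) : concat_fun @^-1` A =
  (first_half `&` (fun t => p (ramp 2 0 t)) @^-1` A) `|`
  (second_half `&` (fun t => q (ramp 2 (- 1) t)) @^-1` A).
Proof.
apply/seteqP; split=> t /=.
  by case: (halves t) => ht; [rewrite concat_fun1//; left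
                             |rewrite concat_fun2//; right].
by move=> [[ht]|[ht]]; [rewrite concat_fun1|rewrite concat_fun2].
Qed.

Let concat_continuous : continuous concat_fun.
Proof.
apply/continuous_closedP => A cA; rewrite concat_preimage.
apply: closedU; apply: closedI.
- exact: closed_first_half.
- apply: closed_comp => // t _.
  exact: (@cts_fun I Y (p \o ramp 2 0)).
- exact: closed_second_half.
- apply: closed_comp => // t _.
  exact: (@cts_fun I Y (q \o ramp 2 (- 1))).
Qed.

Definition concat : continuousType I Y := mkcts concat_continuous.

Lemma concat_first_half t : first_half t -> concat t = p (ramp 2 0 t).
Proof. exact: concat_fun1. Qed.

Lemma concat_second_half t : second_half t -> concat t = q (ramp 2 (- 1) t).
Proof. exact: concat_fun2. Qed.

Lemma concat_I0 : concat I0 = p I0.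
Proof.
rewrite concat_first_half; last by rewrite /first_half /= invr_ge0 ler0n.
by rewrite (@rampE _ _ 0) ?clamp0//= mulr0 addr0.
Qed.

Lemma concat_I1 : concat I1 = q I1.
Proof.
rewrite concat_second_half.
  by rewrite (@rampE _ _ 1) ?clamp1//= mulr1; lra.
by rewrite /second_half /= invf_le1 ?ler1n ?ltr0n.
Qed.

End concat.

(** A concatenation maps a compact K into O iff its two pieces map the two
    parts of K, still compact, into O: the preimage of a subbasic open set is an
    intersection of two subbasic ones. *)
Lemma concat_is_continuous (S Y : topologicalType) (f g : S -> map_space I Y)
    (fg : forall s, (f s : continuousType I Y) I1 = (g s : continuousType I Y) I0) :
  continuous f -> continuous g ->
  continuous (fun s => concat (fg s) : map_space I Y).
Proof.
move=> cf cg; apply: continuous_to_map_space => K O cK oO.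
have -> : [set s | (concat (fg s) : continuousType I Y) @` K `<=` O] =
    [set s | (precomp (ramp 2 0) (f s) : continuousType I Y) @`
      (K `&` first_half) `<=` O] `&`
    [set s | (precomp (ramp 2 (- 1)) (g s) : continuousType I Y) @`
      (K `&` second_half) `<=` O].
  apply/seteqP; split=> [s sO|s [fO gO] _ [t Kt <-]].
    split=> _ [t [Kt ht] <-].
      by rewrite /= -(concat_first_half (fg s) ht); apply: sO; exists t.
    by rewrite /= -(concat_second_half (fg s) ht); apply: sO; exists t.
  case: (halves t) => ht.
    by rewrite concat_first_half//; apply: fO; exists t.
  by rewrite concat_second_half//; apply: gO; exists t.
have open_part (h : S -> map_space I Y) (a : continuousType I I) (B : set I) :
    continuous h -> closed B ->
    open [set s | (precomp a (h s) : continuousType I Y) @` (K `&` B) `<=` O].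
  move=> ch cB; have := map_space_open (compact_closedI cK cB) oO.
  apply: (continuousP _).1 => s.
  apply: (@continuous_comp _ (map_space I Y) _ h (precomp a)); first exact: ch.
  exact: precomp_continuous.
apply: openI; apply: open_part => //; first exact: closed_first_half.
exact: closed_second_half.
Qed.

End paths.

(** * Families of paths over a diagram of spaces *)

Section kprod_projections.
Variables S T : topologicalType.

Lemma kprod_fst_continuous : continuous (fst : kprod S T -> S).
Proof.
move=> z; apply: (@continuous_comp (kprod S T) (S * T)%type S id fst).
  exact: continuous_of_kification.
exact: cvg_fst.
Qed.

Lemma kprod_snd_continuous : continuous (snd : kprod S T -> T).
Proof.
move=> z; apply: (@continuous_comp (kprod S T) (S * T)%type T id snd).
  exact: continuous_of_kification.
exact: cvg_snd.
Qed.

End kprod_projections.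

Section cmap_proj.
Variables (C : smallCategory) (X Y : cspace C).

Definition cmap_fst : cmap (prod_cspace X Y) X :=
  @CMap C (prod_cspace X Y) X
    (fun c => mkcts (@kprod_fst_continuous (X c) (Y c))) (fun _ _ _ _ => erefl).

Definition cmap_snd : cmap (prod_cspace X Y) Y :=
  @CMap C (prod_cspace X Y) Y
    (fun c => mkcts (@kprod_snd_continuous (X c) (Y c))) (fun _ _ _ _ => erefl).

End cmap_proj.

Lemma chomotopic_refl (R : realType) (C : smallCategory) (X Y : cspace C)
  (f : cmap X Y) : chomotopic R f f.
Proof. by exists (cmap_comp f (cmap_fst _ _)). Qed.

Section path_cmaps.
Variables (R : realType) (C : smallCategory) (A Y : cspace C).
Local Notation I := (unit_interval R).
Local Notation path c := (continuousType I (Y c)).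

Lemma path_cmap_continuous (s : cmap A (path_cspace R Y)) c :
  continuous (s c : A c -> map_space I (Y c)).
Proof.
move=> x; apply: (@continuous_comp _ (kmap I (Y c)) (map_space I (Y c)) (s c) id).
  exact: cts_fun.
exact: continuous_of_kification.
Qed.

Section transpose.
Variable G : cmap (prod_cspace A (const_cspace C I)) Y.

Let transpose_fun c (x : A c) : kmap I (Y c) := slice (G c) x.

Let transpose_continuous c : continuous (@transpose_fun c).
Proof.
apply: continuous_to_kification; apply: slice_is_continuous.
  exact: unit_interval_compact.
exact: unit_interval_hausdorff.
Qed.

Let transpose_natural (a b : C) (f : Defs.hom a b) (x : A a) :
  transpose_fun (cs_map A f x) = cs_map (path_cspace R Y) f (transpose_fun x).
Proof. by apply/continuousEP => t; exact: (cm_natural G f (x, t)). Qed.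

Definition transpose : cmap A (path_cspace R Y) :=
  @CMap C A (path_cspace R Y) (fun c => mkcts (@transpose_continuous c))
    transpose_natural.

Lemma transposeE c (x : A c) t : (transpose c x : path c) t = G c (x, t).
Proof. by []. Qed.

End transpose.

Section creverse.
Variable s : cmap A (path_cspace R Y).

Let creverse_fun c (x : A c) : kmap I (Y c) := reverse (s c x).

Let creverse_continuous c : continuous (@creverse_fun c).
Proof.
apply: continuous_to_kification => x.
apply: (@continuous_comp _ (map_space I (Y c)) _ (s c) (@reverse R (Y c))).
  exact: path_cmap_continuous.
exact: precomp_continuous.
Qed.

Let creverse_natural (a b : C) (f : Defs.hom a b) (x : A a) :
  creverse_fun (cs_map A f x) = cs_map (path_cspace R Y) f (creverse_fun x).
Proof. by apply/continuousEP => t; rewrite /creverse_fun cm_natural. Qed.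

Definition creverse : cmap A (path_cspace R Y) :=
  @CMap C A (path_cspace R Y) (fun c => mkcts (@creverse_continuous c))
    creverse_natural.

Lemma creverse_I0 c (x : A c) :
  (creverse c x : path c) I0 = (s c x : path c) I1.
Proof. exact: reverse_I0. Qed.

Lemma creverse_I1 c (x : A c) :
  (creverse c x : path c) I1 = (s c x : path c) I0.
Proof. exact: reverse_I1. Qed.

End creverse.

Section cconcat.
Variables s t : cmap A (path_cspace R Y).
Hypothesis st : forall c x, (s c x : path c) I1 = (t c x : path c) I0.

Let cconcat_fun c (x : A c) : kmap I (Y c) := concat (st x).

Let cconcat_continuous c : continuous (@cconcat_fun c).
Proof.
apply: continuous_to_kification; apply: concat_is_continuous;
  exact: path_cmap_continuous.
Qed.

Let cconcat_natural (a b : C) (f : Defs.hom a b) (x : A a) :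
  cconcat_fun (cs_map A f x) = cs_map (path_cspace R Y) f (cconcat_fun x).
Proof.
apply/continuousEP => r; rewrite /= /path_fun /=.
rewrite /cconcat_fun; case: (halves r) => hr.
  by rewrite !concat_first_half// cm_natural.
by rewrite !concat_second_half// cm_natural.
Qed.

Definition cconcat : cmap A (path_cspace R Y) :=
  @CMap C A (path_cspace R Y) (fun c => mkcts (@cconcat_continuous c))
    cconcat_natural.

Lemma cconcat_I0 c (x : A c) :
  (cconcat c x : path c) I0 = (s c x : path c) I0.
Proof. exact: concat_I0. Qed.

Lemma cconcat_I1 c (x : A c) :
  (cconcat c x : path c) I1 = (t c x : path c) I1.
Proof. exact: concat_I1. Qed.

End cconcat.

End path_cmaps.

(** * Strictifying lifts through the endpoint map *)

(** The path over x is the first coordinate of the homotopy run backwards, then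
    s x, then the second coordinate of the homotopy. *)
Lemma rectified_lift (R : realType) (C : smallCategory) (A X : cspace C)
    (s : cmap A (path_cspace R X)) (g : cmap A (prod_cspace X X)) :
  chomotopic R (cmap_comp (endpoints R X) s) g ->
  exists s' : cmap A (path_cspace R X), cmap_comp (endpoints R X) s' = g.
Proof.
move=> [H H01].
pose trail1 := transpose (cmap_comp (cmap_fst X X) H).
pose trail2 := transpose (cmap_comp (cmap_snd X X) H).
have joint1 c x : (creverse trail1 c x : continuousType _ (X c)) I1 =
    (s c x : continuousType _ (X c)) I0.
  by rewrite creverse_I1 transposeE /= (H01 c x).1.
have joint2 c x : (cconcat joint1 c x : continuousType _ (X c)) I1 =
    (trail2 c x : continuousType _ (X c)) I0.
  by rewrite cconcat_I1 transposeE /= (H01 c x).1.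
exists (cconcat joint2); apply/cmapP => c x.
transitivity ((cconcat joint2 c x : continuousType (unit_interval R) (X c)) I0,
  (cconcat joint2 c x : continuousType (unit_interval R) (X c)) I1) => //.
rewrite !cconcat_I0 cconcat_I1 creverse_I0 !transposeE /= (H01 c x).2.
by rewrite -surjective_pairing.
Qed.

Theorem corollary5p7 (R : realType) (C : smallCategory) (X : cspace C) :
  TC R X =
  least (fun n : nat =>
    exists U : 'I_n.+1 -> open_csubspace (prod_cspace X X),
      open_cover U /\
      forall i, exists s : cmap (U i) (path_cspace R X),
        cmap_comp (endpoints R X) s = csub_incl (U i)).
Proof.
rewrite /TC /sec; congr least; apply/funext => n; apply/propext.
split=> -[U [covU sU]]; exists U; split=> // i; have [s] := sU i.
  exact: rectified_lift.
by move=> sE; exists s; rewrite /homotopy_local_section sE; exact: chomotopic_refl.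
Qed.
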